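(* Let $d\ge 4$ be an integer. For every triple $\mathscr{L}=(L_1,L_2,L_3)$ of pairwise distinct elements of $\mathbb{P}S_1$, there are exactly $\binom{d-1}{2}$ distinct forms in $\mathbb{P}S_d$ that have Waring rank two and are multiples of $L_1L_2L_3$. Moreover, the union of the sets $\Pi(\mathscr{L})\cap\overline{\Sigma}$, over all triples $\mathscr{L}$ of pairwise distinct elements of $\mathbb{P}S_1$, is equal to $\Sigma\setminus\mathcal{C}$, the set of all forms $F\in\mathbb{P}S_d$ with Waring rank two.
   Context: $S=\mathbb{C}[x,y]$, $S_i$ is the space of forms of degree $i$, and $\mathbb{P}S_i$ is its projectivization (forms up to nonzero scalar). The Waring rank of a nonzero form $F\in S_d$ is the least $m$ such that $F=a_1L_1^d+\dots+a_mL_m^d$ with $a_k\in\mathbb{C}$, $L_k\in S_1$; it is invariant under scaling, so it is defined on $\mathbb{P}S_d$. $\mathcal{C}\subseteq\mathbb{P}S_d$ is the rational normal curve, the image of $\mathbb{P}S_1\to\mathbb{P}S_d$, $L\mapsto L^d$. $\Sigma\subseteq\mathbb{P}S_d$ is the union of all lines spanned by two different points of $\mathcal{C}$, and $\overline{\Sigma}$ is its Zariski closure (the second secant variety of $\mathcal{C}$). For $\mathscr{L}=(L_1,L_2,L_3)$ a triple of pairwise distinct elements of $\mathbb{P}S_1$, $\Pi(\mathscr{L})$ is the set of $F\in\mathbb{P}S_d$ that are multiples of $L_1L_2L_3$. *)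

(* Defs.v *)
From HB Require Import structures.
From mathcomp Require Import all_boot all_order all_algebra.
From mathcomp Require Import boolp classical_sets functions cardinality reals.
From mathcomp Require Import complex mpoly.

Set Implicit Arguments.
Unset Strict Implicit.
Unset Printing Implicit Defensive.

Import GRing.Theory.

Local Open Scope ring_scope.
Local Open Scope complex_scope.
Local Open Scope classical_set_scope.

Section Projective.
Variables (K : fieldType) (V : vectType K).

(* A point of the projectivization of V is a one-dimensional subspace of V,
   so that equality of points is Leibniz equality. *)
Record proj := Proj { line : {vspace V}; _ : \dim line == 1%N }.

HB.instance Definition _ := [isSub for line].
HB.instance Definition _ := [Choice of proj by <:].

Implicit Types (p : proj) (v : V).

Lemma dim_vline_neq0 v : v != 0 -> \dim <[v]> == 1%N.
Proof. by move=> v0; rewrite dim_vline v0. Qed.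

Definition point v (v0 : v != 0) : proj := Proj (dim_vline_neq0 v0).

Definition rep p : V := vpick (line p).

Lemma rep_neq0 p : rep p != 0.
Proof. by rewrite vpick0 -dimv_eq0 (eqP (valP p)). Qed.

Lemma mem_rep p : rep p \in line p.
Proof. exact: memv_pick. Qed.

(* Another choice of basis changes P by a linear substitution, hence gives the
   same closed sets. *)
Definition zeros (P : set {mpoly K[\dim {: V}]}) : set proj :=
  [set p : proj | forall f, P f -> forall v, v \in line p ->
     f.@[fun i => coord (vbasis {: V}) i v] = 0].

Definition zariski_closed (A : set proj) : Prop :=
  exists P : set {mpoly K[\dim {: V}]},
    (forall f, P f -> exists k, f \is k.-homog) /\ A = zeros P.

Definition zariski_closure (A : set proj) : set proj :=
  smallest zariski_closed A.

End Projective.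

Section BinaryForms.
Variable R : realType.

Definition form (d : nat) := dhomog 2 R[i] d.

Definition pform (d : nat) := proj (form d).

Section Degree.
Variable d : nat.

Definition waring_sum (F : form d) (m : nat) : Prop :=
  exists (a : 'I_m -> R[i]) (L : 'I_m -> form 1),
    (F : {mpoly R[i][2]}) = \sum_(k < m) a k *: (L k : {mpoly R[i][2]}) ^+ d.

Definition has_waring_rank (F : form d) (m : nat) : Prop :=
  waring_sum F m /\ forall m', waring_sum F m' -> (m <= m')%N.

Lemma waring_sumZ (c : R[i]) (F : form d) m :
  waring_sum F m -> waring_sum (c *: F) m.
Proof.
move=> [a [L FE]]; exists (fun k => c * a k), L.
by rewrite linearZ /= FE scaler_sumr; apply: eq_bigr => k _; rewrite scalerA.
Qed.

Lemma has_waring_rankZ (c : R[i]) (F : form d) m :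
  c != 0 -> has_waring_rank (c *: F) m <-> has_waring_rank F m.
Proof.
move=> c0; have WE m' : waring_sum (c *: F) m' <-> waring_sum F m'.
  split; last exact: waring_sumZ.
  by move/(waring_sumZ c^-1); rewrite scalerA mulVf // scale1r.
by split=> -[/WE ? mn]; split=> // m' /WE; apply: mn.
Qed.

Definition pwaring_rank (p : pform d) (m : nat) : Prop :=
  has_waring_rank (rep p) m.

Lemma form_pow_homog (L : form 1) : (L : {mpoly R[i][2]}) ^+ d \is d.-homog.
Proof. by have := dhomogMn d (dhomog_is_dhomog L); rewrite mul1n. Qed.

Definition form_pow (L : form 1) : form d := DHomog (form_pow_homog L).

Lemma form_pow_neq0 (L : form 1) : L != 0 -> form_pow L != 0.
Proof. by move=> L0; rewrite -val_eqE /= expf_neq0. Qed.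

Definition veronese (l : pform 1) : pform d :=
  point (form_pow_neq0 (rep_neq0 l)).

Definition rational_normal_curve : set (pform d) := range veronese.

Definition secant_union : set (pform d) :=
  [set p : pform d | exists a b, [/\ rational_normal_curve a, rational_normal_curve b,
     a <> b & (line p <= line a + line b)%VS]].

Definition triple_multiples (L : 3.-tuple (pform 1)) : set (pform d) :=
  [set p : pform d | exists G : {mpoly R[i][2]},
     (rep p : {mpoly R[i][2]})
       = G * \prod_(l <- L) (rep l : {mpoly R[i][2]})].

End Degree.
End BinaryForms.

Arguments rational_normal_curve : clear implicits.
Arguments secant_union : clear implicits.

(* Main.v *)
Require Import Defs.
From mathcomp Require Import all_boot all_order all_algebra all_field.
From mathcomp Require Import boolp classical_sets functions cardinality reals.
From mathcomp Require Import complex perm cyclic ring mpoly.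

(* A binary form of degree d is handled through the sequence s_0, ..., s_d of its
   coefficients divided by binomials: the power (p X + q Y)^d has s_j =
   p^j q^(d-j), which is killed by s |-> q s_(j+1) - p s_j. Composing three such
   operators shows that the d-th powers of four pairwise distinct linear forms
   are independent for d >= 3.
     The 3x3 minors of the catalecticant matrix (s_(i+j)) vanish on the secant
   variety. When they vanish, s satisfies a recurrence of order two, so the form
   is a combination of two d-th powers or L^(d-1) M; the latter has no three
   distinct linear factors.
     A form u^d - v^d is divisible by L1 L2 L3 exactly when u/v takes, at the
   three roots, values with equal d-th powers. Normalizing the first value to 1,
   the others are z^i and z^j with z a primitive d-th root of unity and i, j
   distinct in 1..d-1; they determine u/v, which is a Moebius transformation.
   Exchanging u and v replaces (i, j) with (d-i, d-j), so the forms correspond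
   to the pairs i < j. *)

Set Implicit Arguments.
Unset Strict Implicit.
Unset Printing Implicit Defensive.

Import GRing.Theory Num.Theory.

Local Open Scope ring_scope.

(** * Powers of linear forms as sequences *)

Section Brackets.
Variable K : fieldType.
Implicit Types (u v w l : K * K) (s : nat -> K).

(** A pair holds the coefficients of a linear form. The determinant of two pairs is, up to sign, the
    value of one form at the root of the other; its vanishing means proportionality. *)
Definition br u v : K := u.1 * v.2 - u.2 * v.1.

Lemma brC u v : br u v = - br v u.
Proof. by rewrite /br; ring. Qed.

Lemma bruu u : br u u = 0.
Proof. by rewrite /br; ring. Qed.

Lemma br_neq0C u v : (br u v != 0) = (br v u != 0).
Proof. by rewrite brC oppr_eq0. Qed.

Definition scale (c : K) u : K * K := (c * u.1, c * u.2).

Lemma brZl c u v : br (scale c u) v = c * br u v.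
Proof. by rewrite /br /=; ring. Qed.

Lemma brZr c u v : br u (scale c v) = c * br u v.
Proof. by rewrite /br /=; ring. Qed.

Lemma pair_neq0 u : (u != 0) = (u.1 != 0) || (u.2 != 0).
Proof. by case: u => a b; rewrite -negb_and. Qed.

Lemma br_neq0l u v : br u v != 0 -> u != 0.
Proof. by apply: contraNneq => ->; rewrite /br !mul0r subrr. Qed.

Lemma br_neq0r u v : br u v != 0 -> v != 0.
Proof. by rewrite br_neq0C; apply: br_neq0l. Qed.

Lemma br_eq0P u v : v != 0 -> reflect (exists c, u = scale c v) (br u v == 0).
Proof.
move=> v0; apply: (iffP eqP) => [|[c ->]]; last by rewrite brZl bruu mulr0.
case: u v v0 => a b [p q] /=; rewrite pair_neq0 /br /scale /= => nz uv.
have {}uv : a * q = b * p by apply/eqP; rewrite -subr_eq0 uv.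
case/orP: nz => nz.
  by exists (a / p); rewrite divfK // mulrAC uv mulfK.
by exists (b / q); rewrite divfK // mulrAC -uv mulfK.
Qed.

Lemma br_trans v u w : v != 0 -> br u v = 0 -> br w v = 0 -> br u w = 0.
Proof.
move=> v0 /eqP/(br_eq0P _ v0)[c ->] /eqP/(br_eq0P _ v0)[c' ->].
by rewrite brZl brZr bruu !mulr0.
Qed.

Definition pows d u : nat -> K := fun j => u.1 ^+ j * u.2 ^+ (d - j).

Lemma powsZ d c u j : (j <= d)%N -> pows d (scale c u) j = c ^+ d * pows d u j.
Proof.
move=> jd; have -> : c ^+ d = c ^+ j * c ^+ (d - j) by rewrite -exprD subnKC.
by rewrite /pows /= !exprMn; ring.
Qed.

Lemma pows_neq0 d u : u != 0 -> exists2 j, (j <= d)%N & pows d u j != 0.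
Proof.
rewrite pair_neq0 => /orP[p0|q0].
  by exists d => //; rewrite /pows subnn mulr1 expf_neq0.
by exists 0%N => //; rewrite /pows subn0 mul1r expf_neq0.
Qed.

Definition shift u s : nat -> K := fun j => u.2 * s j.+1 - u.1 * s j.

(** The operator lowers the degree by one and multiplies by a bracket, so it kills exactly the
    powers of forms proportional to [u]. *)
Lemma shift_pows d u v j : (j <= d)%N ->
  shift u (pows d.+1 v) j = br v u * pows d v j.
Proof.
by move=> jd; rewrite /shift /pows /br subSS subSn // !exprS; ring.
Qed.

Lemma eq_shift d u s t : (forall j, (j <= d.+1)%N -> s j = t j) ->
  forall j, (j <= d)%N -> shift u s j = shift u t j.
Proof. by move=> st j jd; rewrite /shift !st // leqW. Qed.

Lemma eq_shiftZ d u c s t : (forall j, (j <= d.+1)%N -> s j = c * t j) ->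
  forall j, (j <= d)%N -> shift u s j = c * shift u t j.
Proof. by move=> st j jd; rewrite /shift !st //; [ring|exact: leqW]. Qed.

Lemma shiftC u v s j : shift u (shift v s) j = shift v (shift u s) j.
Proof. by rewrite /shift; ring. Qed.

(** The kernel is one-dimensional: for [q] nonzero the sequence is geometric and fixed by its entry
    at 0; for [q = 0] only the entry at [d] survives. *)
Lemma shift_eq0 d u s : u != 0 -> (forall j, (j < d)%N -> shift u s j = 0) ->
  exists t, forall j, (j <= d)%N -> s j = t * pows d u j.
Proof.
case: u => p q; rewrite pair_neq0 /shift /pows /= => nz s0.
have [q0|q0] := eqVneq q 0.
  have {nz}p0 : p != 0 by move: nz; rewrite q0 eqxx orbF.
  exists (s d / p ^+ d) => j; rewrite leq_eqVlt => /predU1P[->|jd].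
    by rewrite subnn mulr1 divfK // expf_neq0.
  rewrite q0 expr0n subn_eq0 leqNgt jd /= !mulr0.
  have /eqP := s0 _ jd.
  by rewrite q0 mul0r sub0r oppr_eq0 mulf_eq0 (negPf p0) => /eqP.
exists (s 0%N / q ^+ d); elim=> [|j IH] jd.
  by rewrite subn0 mul1r divfK // expf_neq0.
have /eqP := s0 _ jd; rewrite subr_eq0 IH 1?ltnW // => /eqP E.
move: (s _ / _) E => t E; apply: (mulfI q0).
by rewrite E -(@subnSK j d) // !exprS; ring.
Qed.

(** Shifting by [v], [w] and [x] kills the right side and multiplies the left by nonzero brackets.
    As [v], [w], [x] may coincide, relations among fewer powers are covered too. *)
Lemma pows_indep d (u v w x : K * K) (a b c e : K) : (3 <= d)%N ->
    u != 0 -> br u v != 0 -> br u w != 0 -> br u x != 0 ->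
    (forall j, (j <= d)%N ->
       a * pows d u j = b * pows d v j + c * pows d w j + e * pows d x j) ->
  a = 0.
Proof.
case: d => [|[|[|d]]] // _ u0 uv uw ux E.
have [j jd nz] := pows_neq0 d u0.
have {E}E : shift v (shift w (shift x (fun j => a * pows d.+3 u j))) j
  = shift v (shift w (shift x (fun j => b * pows d.+3 v j + c * pows d.+3 w j
      + e * pows d.+3 x j))) j.
  by apply: (@eq_shift d) jd => ? ?; apply: (@eq_shift d.+1) => // ? ?;
    apply: (@eq_shift d.+2).
have S y j' : (j' <= d)%N -> shift v (shift w (shift x (pows d.+3 y))) j'
    = br y v * br y w * br y x * pows d y j'.
  move=> jd'.
  have S1 i : (i <= d.+2)%N -> shift x (pows d.+3 y) i = br y x * pows d.+2 y i.
    exact: shift_pows.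
  have S2 i : (i <= d.+1)%N -> shift w (shift x (pows d.+3 y)) i
      = br y x * br y w * pows d.+1 y i.
    by move=> id; rewrite (eq_shiftZ _ S1) // shift_pows // mulrA.
  by rewrite (eq_shiftZ _ S2) // shift_pows //; ring.
have {E} : a * shift v (shift w (shift x (pows d.+3 u))) j
   = b * shift v (shift w (shift x (pows d.+3 v))) j
   + c * shift v (shift w (shift x (pows d.+3 w))) j
   + e * shift v (shift w (shift x (pows d.+3 x))) j.
  apply: etrans (etrans E _); rewrite /shift; ring.
rewrite !S // !bruu !(mul0r, mulr0, addr0) => /eqP.
by rewrite mulf_eq0 (negPf (mulf_neq0 (mulf_neq0 (mulf_neq0 uv uw) ux) nz)) orbF
  => /eqP.
Qed.

End Brackets.

(** * Sequences satisfying a recurrence of order two *)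

Section Recurrences.
Variable K : numClosedFieldType.
Implicit Types (u v m r : K * K) (s : nat -> K).

Definition hankel_minor s n (f : 'I_3 -> 'I_n) : K :=
  \det (\matrix_(i < 3, j < 3) s (f i + j)%N).

(** A matrix with three columns and rank three would have an invertible 3x3 row submatrix, so the
    rank drops; a vector of the right kernel is the recurrence. *)
Lemma hankel_recurrence s n : (forall f, @hankel_minor s n f = 0) ->
  exists2 c : 'cV[K]_3, c != 0 &
    forall i : 'I_n, \sum_(j < 3) s (i + j)%N * c j 0 = 0.
Proof.
move=> H; pose A := \matrix_(i < n, j < 3) s (i + j)%N.
have rkA : (\rank A < 3)%N.
  rewrite ltn_neqAle rank_leq_col andbT; apply/negP => fullA.
  have := fullrowsub_unit fullA; rewrite unitmxE unitfE => /eqP[].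
  rewrite -[RHS](H (fullrankfun fullA)).
  by congr (\det _); apply/matrixP => i j; rewrite !mxE.
have /matrix0Pn[i [j Cij]] : cokermx A != 0.
  by rewrite -mxrank_eq0 mxrank_coker -lt0n subn_gt0.
exists (col j (cokermx A)).
  by apply: contraNneq Cij => /matrixP/(_ i 0); rewrite mxE [RHS]mxE => ->.
move=> k; have /matrixP/(_ k j) := mulmx_coker A; rewrite mxE [RHS]mxE => {2}<-.
by apply: eq_bigr => l _; rewrite mxE [A _ _]mxE.
Qed.

(** With T the index shift, [shift u] is u.2 T - u.1, so this factors the polynomial a + b T + c T^2
    into linear factors. *)
Lemma quadratic_shift a b c : [|| a != 0, b != 0 | c != 0] ->
  exists u v, [/\ u != 0, v != 0 & forall s j,
    shift u (shift v s) j = a * s j + b * s j.+1 + c * s j.+2].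
Proof.
have [->|c0 _] := eqVneq c 0.
  (* In degree at most one the missing root lies at infinity: the shift by [(-1, 0)] is the
     identity. *)
  rewrite orbF => ab; exists (- a, b), (-1, 0).
  rewrite !pair_neq0 /= !oppr_eq0 oner_eq0; split=> // s j.
  by rewrite /shift /=; ring.
set D := sqrtC (b ^+ 2 - 4 * a * c).
have DD : D ^+ 2 = b ^+ 2 - 4 * a * c by rewrite sqrtCK.
(* The quadratic formula, with the leading coefficient [c] put into the first factor. *)
exists ((- b + D) / 2, c), ((- b - D) / (2 * c), 1).
rewrite !pair_neq0 /= c0 oner_eq0 !orbT; split=> // s j.
rewrite /shift /=.
have -> : a = (b ^+ 2 - D ^+ 2) / (4 * c) by rewrite DD; field; rewrite c0.
by field; rewrite c0.
Qed.

(* Up to the factor d, the sequence of the form u^(d-1) m. *)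
Definition tangent d m u : nat -> K := fun j =>
  m.1 * (j%:R * u.1 ^+ j.-1 * u.2 ^+ (d - j))
  + m.2 * ((d - j)%:R * u.1 ^+ j * u.2 ^+ (d - j).-1).

(** One shift by [u] turns a tangent sequence into a multiple of a power of [u], which a second
    shift would kill: the case of a double root. *)
Lemma shift_tangent n m u j : (j <= n)%N ->
  shift u (tangent n.+1 m u) j = br m u * pows n u j.
Proof.
move=> jn; rewrite /shift /tangent /pows /br subSS subSn //=.
move: (n - j)%N => k.
by case: j jn => [|j] _ /=; case: k => [|k] /=; rewrite ?exprS; ring.
Qed.

Lemma tangent_self d u j : (j <= d)%N -> tangent d u u j = d%:R * pows d u j.
Proof.
move=> jd; have -> : d%:R = j%:R + (d - j)%:R :> K by rewrite -natrD subnKC.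
rewrite /tangent /pows; move: (d - j)%N => k.
by case: j jd => [|j] _ /=; case: k => [|k] /=; rewrite ?exprS; ring.
Qed.

Lemma tangentD d m m' u j :
  tangent d (m + m') u j = tangent d m u j + tangent d m' u j.
Proof. by rewrite /tangent /=; ring. Qed.

Lemma tangentZ d c m u j :
  tangent d (scale c m) u j = c * tangent d m u j.
Proof. by rewrite /tangent /=; ring. Qed.

Lemma br_surj u t : u != 0 -> exists m, br m u = t.
Proof.
rewrite pair_neq0 /br => /orP[u0|u0].
  by exists (0, - t / u.1) => /=; field.
by exists (t / u.2, 0) => /=; field.
Qed.

(** The recurrence factors as two shifts, by [u] and [v]. Independent factors give a sum of two
    powers, proportional ones a tangent sequence. *)
Lemma secant_or_tangent n s : (forall f, @hankel_minor s n.+1 f = 0) ->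
  (exists u v a b, br u v != 0 /\ forall j, (j <= n.+2)%N ->
      s j = a * pows n.+2 u j + b * pows n.+2 v j)
  \/ (exists2 u, u != 0 & exists m, forall j, (j <= n.+2)%N ->
      s j = tangent n.+2 m u j).
Proof.
move=> /hankel_recurrence[c c0 cs].
have [|u [v [u0 v0 uvE]]] := @quadratic_shift (c 0 0) (c 1 0) (c 2%:R 0).
  apply: contraNT c0; rewrite !negb_or !negbK => /and3P[/eqP c0 /eqP c1 /eqP c2].
  apply/eqP/matrixP => i j; rewrite ord1 mxE.
  case: i => [[|[|[|//]]] ?]; [rewrite -[RHS]c0|rewrite -[RHS]c1|rewrite -[RHS]c2];
    by congr (c _ _); apply: val_inj.
have {cs}uvs j : (j < n.+1)%N -> shift u (shift v s) j = 0.
  move=> jn; rewrite uvE -(cs (Ordinal jn)) !big_ord_recl big_ord0 /=.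
  have -> : lift ord0 (lift ord0 ord0) = 2%:R :> 'I_3 by apply: val_inj.
  have -> : lift ord0 ord0 = 1 :> 'I_3 by apply: val_inj.
  by rewrite addn0 addn1 addn2; ring.
have [t tE] : exists t, forall j, (j <= n.+1)%N -> shift v s j = t * pows n.+1 u j.
  exact: shift_eq0.
have [uv0|uv0] := eqVneq (br u v) 0; [right | left].
  have [x ux] : exists x, u = scale x v by apply/br_eq0P; rewrite ?uv0.
  (* This [m] makes the shift by [v] of the tangent sequence agree with that of [s], so their
     difference is a multiple of the power of [v]. *)
  have [m mv] := br_surj (t * x ^+ n.+1) v0.
  have [|w wE] := @shift_eq0 _ n.+2 v (fun j => s j - tangent n.+2 m v j) v0.
    move=> j jn.
    transitivity (shift v s j - shift v (tangent n.+2 m v) j).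
      by rewrite /shift; ring.
    by rewrite tE // shift_tangent // ux powsZ // mv; ring.
  (* The leftover multiple of the power of [v] is absorbed into [m] through [tangent_self]. *)
  exists v => //; exists (m + scale (w / n.+2%:R) v) => j jn.
  rewrite tangentD tangentZ tangent_self // mulrA divfK ?pnatr_eq0 // -wE //.
  by rewrite addrC subrK.
have [x xE] : exists x, forall j, (j <= n.+1)%N -> shift u s j = x * pows n.+1 v j.
  by apply: shift_eq0 => // j jn; rewrite shiftC uvs.
(* Both shifts of [s] are known powers, and eliminating between them gives [br u v * s j]. Below the
   last index the entry at [j.+1] is eliminated; at the last index, the previous entry. *)
exists u, v, (t / br u v), (- x / br u v); split=> // j jn.
apply: (mulIf uv0).
transitivity (t * pows n.+2 u j - x * pows n.+2 v j); last by field.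
case: (ltnP j n.+2) => [{}jn|nj].
  have pE w : pows n.+2 w j = w.2 * pows n.+1 w j.
    by rewrite /pows subSn // exprS; ring.
  rewrite !pE; transitivity (u.2 * shift v s j - v.2 * shift u s j).
    by rewrite /shift /br; ring.
  by rewrite tE // xE //; ring.
have -> : j = n.+2 by apply/eqP; rewrite eqn_leq jn.
have pE w : pows n.+2 w n.+2 = w.1 * pows n.+1 w n.+1.
  by rewrite /pows !subnn exprS; ring.
rewrite !pE; transitivity (u.1 * shift v s n.+1 - v.1 * shift u s n.+1).
  by rewrite /shift /br; ring.
by rewrite tE // xE //; ring.
Qed.

End Recurrences.

(** * Coefficients of binary forms *)

Section Coefficients.
Variable K : numClosedFieldType.
Implicit Types (u v m r : K * K) (s t : nat -> K) (F G : {mpoly K[2]}).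

Definition mono d j : 'X_{1..2} :=
  [multinom (if i == ord0 then j else d - j)%N | i < 2].

Definition mform d s : {mpoly K[2]} :=
  \sum_(j < d.+1) ('C(d, j)%:R * s j) *: 'X_[mono d j].

(** Inverse to [mform] on indices up to [d]; dividing by binomials makes the d-th powers correspond
    to [pows]. *)
Definition cf d F j : K := F@_(mono d j) / 'C(d, j)%:R.

Definition linear_form u : {mpoly K[2]} := u.1 *: 'X_ord0 + u.2 *: 'X_ord_max.

Definition vec r : 'I_2 -> K := fun i => if i == ord0 then r.1 else r.2.

Lemma monoE d j : 'X_[mono d j] = 'X_ord0 ^+ j * 'X_ord_max ^+ (d - j) :> {mpoly K[2]}.
Proof.
rewrite mpolyXE_id !big_ord_recl big_ord0 mulr1 !mnmE /=.
by congr (_ * 'X_ _ ^+ _); apply: val_inj.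
Qed.

Lemma mono_inj d i j : (i <= d)%N -> (mono d i == mono d j) = (i == j).
Proof.
move=> id; apply/eqP/eqP => [/mnmP/(_ ord0)|->//].
by rewrite !mnmE.
Qed.

Lemma mform_mcoeff d s j : (j <= d)%N -> (mform d s)@_(mono d j) = 'C(d, j)%:R * s j.
Proof.
move=> jd; rewrite raddf_sum (bigD1 (Ordinal (jd : j < d.+1)%N)) //= mcoeffZ mcoeffX eqxx.
rewrite mulr1 big1 ?addr0 // => i ij; rewrite mcoeffZ mcoeffX mono_inj ?leq_ord //.
by rewrite -val_eqE /= in ij; rewrite (negPf ij) mulr0.
Qed.

Lemma bin_neq0 d j : (j <= d)%N -> 'C(d, j)%:R != 0 :> K.
Proof. by move=> jd; rewrite pnatr_eq0 -lt0n bin_gt0. Qed.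

Lemma cf_mform d s j : (j <= d)%N -> cf d (mform d s) j = s j.
Proof. by move=> jd; rewrite /cf mform_mcoeff // mulrC mulKf // bin_neq0. Qed.

Lemma eq_mform d s t : (forall j, (j <= d)%N -> s j = t j) -> mform d s = mform d t.
Proof. by move=> st; apply: eq_bigr => j _; rewrite st // leq_ord. Qed.

(** In two variables a monomial of degree [d] is determined by its first exponent, and monomials of
    other degrees have coefficient zero on both sides. *)
Lemma mformK d F : F \is d.-homog -> F = mform d (cf d F).
Proof.
move=> /dhomogP Fd; apply/mpolyP => m.
have [md|md] := eqVneq (mdeg m) d.
  have -> : m = mono d (m ord0).
    apply/mnmP => i; rewrite mnmE; have [-> //|i0] := eqVneq i ord0.
    rewrite -md mdegE !big_ord_recl big_ord0 addn0 addKn; congr (m _).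
    by apply: val_inj; case: i i0 => [[|[|]]].
  have le : (m ord0 <= d)%N by rewrite -md mdegE (bigD1 ord0) //= leq_addr.
  by rewrite mform_mcoeff // /cf mulrC divfK // bin_neq0.
rewrite memN_msupp_eq0; last by apply: contra md => /Fd/eqP.
rewrite raddf_sum big1 //= => j _; rewrite mcoeffZ mcoeffX.
case: eqP => [E|_]; last by rewrite mulr0.
case/negP: md; rewrite -E mdegE !big_ord_recl big_ord0 !mnmE /= addn0.
by rewrite subnKC // leq_ord.
Qed.

Lemma mform_homog d s : mform d s \is d.-homog.
Proof.
apply: rpred_sum => j _; apply: dhomogZ; rewrite dhomogX [X in X == _](mdegE (mono d j)).
by rewrite !big_ord_recl big_ord0 !mnmE /= addn0 subnKC // leq_ord.
Qed.

Lemma cfD d F G j : cf d (F + G) j = cf d F j + cf d G j.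
Proof. by rewrite /cf mcoeffD mulrDl. Qed.

Lemma cfB d F G j : cf d (F - G) j = cf d F j - cf d G j.
Proof. by rewrite /cf mcoeffB mulrBl. Qed.

Lemma cfZ d a F j : cf d (a *: F) j = a * cf d F j.
Proof. by rewrite /cf mcoeffZ mulrA. Qed.

Lemma linear_form_pow d u : linear_form u ^+ d = mform d (pows d u).
Proof.
rewrite /linear_form addrC exprDn; apply: eq_bigr => j _.
by rewrite monoE !exprZn -scalerAl -scalerAr scalerA -scaler_nat scalerA /pows
  [_ * 'X_ord_max ^+ _]mulrC [_ * u.1 ^+ _]mulrC.
Qed.

Lemma cf_linear_pow d u j : (j <= d)%N -> cf d (linear_form u ^+ d) j = pows d u j.
Proof. by move=> jd; rewrite linear_form_pow cf_mform. Qed.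

Lemma linear_formP F : F \is 1.-homog -> exists u, F = linear_form u.
Proof.
move=> /mformK FE; exists (cf 1 F 1, cf 1 F 0).
rewrite {1}FE /linear_form /mform !big_ord_recl big_ord0 addr0 !monoE /=.
by rewrite !mul1r mulr1 addrC.
Qed.

Lemma linear_form_homog u : linear_form u \is 1.-homog.
Proof. by rewrite -[linear_form u]expr1 linear_form_pow mform_homog. Qed.

Lemma linear_form_inj : injective linear_form.
Proof.
move=> u v uv; have E j : (j <= 1)%N -> pows 1 u j = pows 1 v j.
  by move=> j1; rewrite -!cf_linear_pow // uv.
move: (E 0%N isT) (E 1%N isT); rewrite /pows !mul1r !mulr1.
by case: u v {uv E} => ? ? [? ?] /=; rewrite !expr1 => -> ->.
Qed.

Lemma linear_formB u v : linear_form (u - v) = linear_form u - linear_form v.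
Proof. by rewrite /linear_form /= !scalerBl; ring. Qed.

Lemma linear_formZ a u : linear_form (scale a u) = a *: linear_form u.
Proof. by rewrite /linear_form /= scalerDr !scalerA. Qed.

Lemma meval_linear u r : (linear_form u).@[vec r] = u.1 * r.1 + u.2 * r.2.
Proof. by rewrite mevalD !mevalZ !mevalXU. Qed.

Lemma meval_mform d s r : (mform d s).@[vec r]
  = \sum_(j < d.+1) 'C(d, j)%:R * s j * (r.1 ^+ j * r.2 ^+ (d - j)).
Proof.
rewrite raddf_sum; apply: eq_bigr => j _ /=.
by rewrite mevalZ monoE mevalM !rmorphXn /= !mevalXU.
Qed.

(** Justifies the name: the form is (n+1) u^n m. The two summands of [tangent] are treated
    separately, each with an absorption identity for binomials. *)
Lemma meval_tangent n m u r : (mform n.+1 (tangent n.+1 m u)).@[vec r]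
  = n.+1%:R * (linear_form u).@[vec r] ^+ n * (linear_form m).@[vec r].
Proof.
rewrite meval_mform !meval_linear.
have -> : (u.1 * r.1 + u.2 * r.2) ^+ n = \sum_(j < n.+1)
    'C(n, j)%:R * (u.1 * r.1) ^+ j * (u.2 * r.2) ^+ (n - j).
  by rewrite addrC exprDn; apply: eq_bigr => j _; rewrite -mulr_natl mulrAC mulrA.
rewrite mulrDr; set S := _ * \sum_(j < _) _.
transitivity (\sum_(j < n.+2) 'C(n.+1, j)%:R
      * (m.1 * (j%:R * u.1 ^+ j.-1 * u.2 ^+ (n.+1 - j))) * (r.1 ^+ j * r.2 ^+ (n.+1 - j))
   + \sum_(j < n.+2) 'C(n.+1, j)%:R
      * (m.2 * ((n.+1 - j)%:R * u.1 ^+ j * u.2 ^+ (n.+1 - j).-1))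
      * (r.1 ^+ j * r.2 ^+ (n.+1 - j))).
  by rewrite -big_split; apply: eq_bigr => j _; rewrite /tangent mulrDr mulrDl.
congr (_ + _).
  (* The factor [j] removes the first term, and the index moves down by one; in the other sum the
     factor [n.+1 - j] removes the last term. *)
  rewrite big_ord_recl mul0r mul0r !mulr0 mul0r add0r /S mulr_sumr mulr_suml.
  apply: eq_bigr => j _; rewrite lift0 /= subSS !exprMn exprS.
  have E : n.+1%:R * 'C(n, j)%:R = j.+1%:R * 'C(n.+1, j.+1)%:R :> K.
    by rewrite -!natrM mul_bin_diag.
  transitivity (j.+1%:R * 'C(n.+1, j.+1)%:R * m.1 * u.1 ^+ j * u.2 ^+ (n - j)
    * r.1 * r.1 ^+ j * r.2 ^+ (n - j)); first by ring.
  by rewrite -E; ring.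
rewrite big_ord_recr /= subnn mul0r mul0r !mulr0 mul0r addr0 /S mulr_sumr mulr_suml.
apply: eq_bigr => j _; have E : n.+1%:R * 'C(n, j)%:R = (n.+1 - j)%:R * 'C(n.+1, j)%:R :> K.
  by rewrite -!natrM mul_bin_down.
transitivity ((n.+1 - j)%:R * 'C(n.+1, j)%:R
    * (m.2 * r.2 * (u.1 * r.1) ^+ j * (u.2 * r.2) ^+ (n - j))).
  by rewrite subSn ?leq_ord //= !exprMn [r.2 ^+ _.+1]exprS; ring.
by rewrite -E; ring.
Qed.

End Coefficients.

(** * Factoring differences of powers, and roots of binary forms *)

Section RootsOfUnity.
Variable K : numClosedFieldType.
Implicit Types (u v w m l : K * K) (F G : {mpoly K[2]}) (z : K).

(** In characteristic zero X^n - 1 is separable, so it has n distinct roots, and one of them is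
    primitive. *)
Lemma prim_root_exists n : (0 < n)%N -> exists z : K, n.-primitive_root z.
Proof.
pose p : {poly K} := 'X^n - 1; have [r Dp] := closed_field_poly_normal p.
move=> n_gt0; rewrite (monicP _) ?monicXnsubC // scale1r in Dp.
have rn1: all n.-unity_root r by apply/allP=> z; rewrite -root_prod_XsubC -Dp.
have sz_r: (n < (size r).+1)%N.
  by rewrite -(size_prod_XsubC r id) -Dp size_XnsubC.
have [|z] := hasP (has_prim_root n_gt0 rn1 _ sz_r); last by exists z.
by rewrite -separable_prod_XsubC -Dp separable_Xn_sub_1 // pnatr_eq0 -lt0n.
Qed.

Lemma subXX_prim (L : fieldType) d (z x y : L) : d.-primitive_root z ->
  x ^+ d - y ^+ d = \prod_(i < d) (x - z ^+ i * y).
Proof.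
move=> z_prim; have d_gt0 := prim_order_gt0 z_prim.
have [->|y0] := eqVneq y 0.
  rewrite expr0n gtn_eqF // subr0 (eq_bigr (fun=> x)) => [|i _].
    by rewrite prodr_const card_ord.
  by rewrite mulr0 subr0.
have /(congr1 (horner^~ (x / y))) := factor_Xn_sub_1 z_prim.
rewrite !hornerE horner_prod big_mkord => /(congr1 ( *%R^~ (y ^+ d))).
rewrite mulrBl expr_div_n divfK ?expf_neq0 // mul1r => <-.
have -> : y ^+ d = \prod_(i < d) y by rewrite prodr_const card_ord.
rewrite -big_split /=; apply: eq_bigr => i _.
by rewrite !hornerE mulrBl divfK.
Qed.

(** The factorization over a field is applied in the fraction field of the polynomial ring, where
    [z] remains primitive. *)
Lemma mpoly_subXX_prim n d z (F G : {mpoly K[n]}) : d.-primitive_root z ->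
  F ^+ d - G ^+ d = \prod_(i < d) (F - z ^+ i *: G).
Proof.
move=> z_prim; apply/eqP; rewrite -tofrac_eq; apply/eqP; rewrite rmorphB !rmorphXn rmorph_prod /=.
rewrite (@subXX_prim _ d (@tofrac _ z%:MP)) => [|].
  apply: eq_bigr => i _.
  by rewrite rmorphB /= -mul_mpolyC rmorphM /= -!rmorphXn.
by rewrite -[@tofrac _ _]/((@tofrac _ \o @mpolyC n K) z) fmorph_primitive_root.
Qed.

Lemma br_two_eq0 w l m : br l m != 0 -> br w l = 0 -> br w m = 0 -> w = 0.
Proof.
move=> lm wl wm; apply/eqP; apply: contraNT lm => w0.
by apply/eqP/(br_trans w0); rewrite brC ?wl ?wm oppr0.
Qed.

Lemma brBl u v l : br (u - v) l = br u l - br v l.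
Proof. by rewrite /br /=; ring. Qed.

Lemma sub_scale_neq0 c u v : br u v != 0 -> u - scale c v != 0.
Proof.
apply: contraNneq => /(congr1 (fun w => br w v)).
by rewrite brBl brZl bruu mulr0 subr0 /br !mul0r subrr => ->.
Qed.

(** The form u - c v vanishes at the root of [l]. *)
Lemma root_linear_dvd c u v l : l != 0 -> br u v != 0 -> br u l = c * br v l ->
  exists a, linear_form u - c *: linear_form v = a *: linear_form l.
Proof.
move=> l0 uv ul; have /(br_eq0P _ l0)[a E] : br (u - scale c v) l == 0.
  by rewrite brBl brZl ul subrr.
by exists a; rewrite -!linear_formZ -linear_formB E.
Qed.

Definition triple_product l1 l2 l3 : {mpoly K[2]} :=
  linear_form l1 * (linear_form l2 * linear_form l3).

Lemma triple_productZ c1 c2 c3 l1 l2 l3 :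
  triple_product (scale c1 l1) (scale c2 l2) (scale c3 l3)
  = (c1 * c2 * c3) *: triple_product l1 l2 l3.
Proof.
rewrite /triple_product !linear_formZ -!(scalerAl, scalerAr) !scalerA.
by congr (_ *: _); ring.
Qed.

Lemma dvd_scale c F G : c != 0 ->
  (exists H, F = H * (c *: G)) <-> (exists H, F = H * G).
Proof.
move=> c0; split=> -[H ->]; first by exists (c *: H); rewrite -scalerAl scalerAr.
by exists (c^-1 *: H); rewrite -scalerAl -scalerAr scalerA mulVf // scale1r.
Qed.

(** Each of the three linear forms divides one factor u - z^i v of the difference, and these three
    factors have different indices. *)
Lemma three_roots_dvd d z (i1 i2 i3 : 'I_d) u v l1 l2 l3 : d.-primitive_root z ->
    br u v != 0 -> br l1 l2 != 0 -> br l1 l3 != 0 -> br l2 l3 != 0 ->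
    br u l1 = z ^+ i1 * br v l1 -> br u l2 = z ^+ i2 * br v l2 ->
    br u l3 = z ^+ i3 * br v l3 ->
  exists G, linear_form u ^+ d - linear_form v ^+ d
    = G * triple_product l1 l2 l3.
Proof.
move=> z_prim uv l12 l13 l23 u1 u2 u3.
(* With equal indices the nonzero linear form u - z^i v would vanish at two distinct points. *)
have neq (i j : 'I_d) l m : br l m != 0 -> br u l = z ^+ i * br v l ->
    br u m = z ^+ j * br v m -> j != i.
  move=> lm ul um; apply: contraNneq (sub_scale_neq0 (z ^+ i) uv) => ji.
  by apply/eqP/(br_two_eq0 lm); rewrite brBl brZl (ul, um) ?ji subrr.
rewrite (mpoly_subXX_prim _ _ z_prim) (bigD1 i1) //= (bigD1 i2) ?(neq i1 i2 l1 l2) //=.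
rewrite (bigD1 i3) ?(neq i1 i3 l1 l3) ?(neq i2 i3 l2 l3) //=.
have [a1 ->] := root_linear_dvd (br_neq0l l12) uv u1.
have [a2 ->] := root_linear_dvd (br_neq0r l12) uv u2.
have [a3 ->] := root_linear_dvd (br_neq0r l13) uv u3.
set P := \prod_(i < d | _) _; exists (a1 *: (a2 *: (a3 *: P))).
rewrite -!(scalerAl, scalerAr); congr (_ *: (_ *: (_ *: _))).
rewrite /triple_product; ring.
Qed.

(** The root of [l], at which evaluation is the bracket with [l]. *)
Definition perp l : K * K := (l.2, - l.1).

Lemma meval_perp u l : (linear_form u).@[vec (perp l)] = br u l.
Proof. by rewrite meval_linear /br /=; ring. Qed.

(** The form is a multiple of u^n m. As [u] vanishes at no more than one of the three points, [m]
    vanishes at two of them and is zero. *)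
Lemma tangent_three_roots n m u l1 l2 l3 : u != 0 ->
    br l1 l2 != 0 -> br l1 l3 != 0 -> br l2 l3 != 0 ->
    (forall l, l \in [:: l1; l2; l3] ->
      (mform n.+1 (tangent n.+1 m u)).@[vec (perp l)] = 0) ->
  mform n.+1 (tangent n.+1 m u) = 0.
Proof.
move=> u0 l12 l13 l23 F0.
have {F0}um l : l \in [:: l1; l2; l3] -> br u l != 0 -> br m l = 0.
  move=> /F0/eqP; rewrite meval_tangent !meval_perp !mulf_eq0 pnatr_eq0 /=.
  by rewrite expf_eq0 => /orP[/andP[_ ->]//|/eqP].
suff -> : m = 0.
  rewrite /mform big1 // => j _.
  by rewrite /tangent !mul0r addr0 mulr0 scale0r.
have um2 l l' : l \in [:: l1; l2; l3] -> l' \in [:: l1; l2; l3] ->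
    br l l' != 0 -> br u l != 0 -> br u l' != 0 -> m = 0.
  by move=> ? ? ll' ul ul'; apply: (br_two_eq0 ll'); apply: um.
have um1 l l' : br l l' != 0 -> br u l = 0 -> br u l' != 0.
  move=> ll' ul; apply: contraNneq u0 => ul'; exact/eqP/(br_two_eq0 ll').
have [u1|u1] := eqVneq (br u l1) 0.
  by apply: (um2 l2 l3); rewrite ?inE ?eqxx ?orbT //; apply: um1 u1.
have [u2|u2] := eqVneq (br u l2) 0.
  by apply: (um2 l1 l3); rewrite ?inE ?eqxx ?orbT //; apply: um1 u2.
by apply: (um2 l1 l2); rewrite ?inE ?eqxx ?orbT.
Qed.

End RootsOfUnity.

(** * Pairs of linear forms with prescribed ratios at three points *)

Section RatiosAtThreePoints.
Variable K : numClosedFieldType.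
Variables (l1 l2 l3 : K * K).
Hypotheses (l12 : br l1 l2 != 0) (l13 : br l1 l3 != 0) (l23 : br l2 l3 != 0).
Implicit Types (u v w m l : K * K) (z : K).

(* The Moebius transformation u / v takes the values 1, x, y at the roots of
   l1, l2, l3. *)
Definition ratios x y u v := [/\ br u v != 0, br u l1 = br v l1,
  br u l2 = x * br v l2 & br u l3 = y * br v l3].

(** The conditions at the first two roots say that u - v = a l1 and u - x v = b l2; solving gives u
    and v as x a l1 - b l2 and a l1 - b l2 over x - 1. The third condition fixes b / a, and
    denominators are cleared. *)
Definition ratio_num x y : K * K :=
  scale (br l2 l3 * (1 - y) * x) l1 - scale (br l1 l3 * (x - y)) l2.

Definition ratio_den x y : K * K :=
  scale (br l2 l3 * (1 - y)) l1 - scale (br l1 l3 * (x - y)) l2.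

Lemma ratios_exist x y : x != 1 -> y != 1 -> x != y ->
  ratios x y (ratio_num x y) (ratio_den x y).
Proof.
move=> x1 y1 xy; split.
- rewrite (_ : br _ _ = br l1 l2 * br l1 l3 * br l2 l3
                * ((1 - y) * (x - y) * (1 - x))); last first.
    by rewrite /ratio_num /ratio_den /br /=; ring.
  by rewrite !mulf_neq0 // subr_eq0 // eq_sym.
- by rewrite /ratio_num /ratio_den /br /=; ring.
- by rewrite /ratio_num /ratio_den /br /=; ring.
by rewrite /ratio_num /ratio_den /br /=; ring.
Qed.

Lemma ratios_uniq x y u v : x != 1 -> y != 1 -> x != y -> ratios x y u v ->
  exists c, u = scale c (ratio_num x y) /\ v = scale c (ratio_den x y).
Proof.
move=> x1 y1 xy [uv u1 u2 u3].
have ex t l : l != 0 -> br u l = t * br v l -> exists a, u - scale t v = scale a l.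
  by move=> l0 ul; apply/br_eq0P; rewrite // brBl brZl ul subrr.
have [a /(congr1 (fun w => (w.1, w.2)))[/= a1 a2]] :
    exists a, u - scale 1 v = scale a l1.
  by apply: ex; rewrite ?mul1r // (br_neq0l l12).
have [b /(congr1 (fun w => (w.1, w.2)))[/= b1 b2]] := ex _ _ (br_neq0r l12) u2.
have y1' : 1 - y != 0 by rewrite subr_eq0 eq_sym.
have x1' : x - 1 != 0 by rewrite subr_eq0.
have v1 : v.1 = (a * l1.1 - b * l2.1) / (x - 1) by rewrite -a1 -b1; field.
have v2 : v.2 = (a * l1.2 - b * l2.2) / (x - 1) by rewrite -a2 -b2; field.
have ud1 : u.1 = v.1 + a * l1.1 by rewrite -a1; ring.
have ud2 : u.2 = v.2 + a * l1.2 by rewrite -a2; ring.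
(* The condition at the third root determines [b] from [a], leaving one common scalar. *)
have bE : b = a * (x - y) * br l1 l3 / ((1 - y) * br l2 l3).
  have : br u l3 - y * br v l3 = 0 by rewrite u3 subrr.
  rewrite {1 2}/br ud1 ud2 v1 v2 => E.
  suff E' : b * ((1 - y) * br l2 l3) = a * (x - y) * br l1 l3.
    by rewrite -E' mulfK // mulf_neq0.
  apply/eqP; rewrite -subr_eq0; apply/eqP.
  by move: (congr1 ( *%R (1 - x)) E); rewrite mulr0 => <-; rewrite /br; field.
exists (a / ((x - 1) * br l2 l3 * (1 - y))).
rewrite /ratio_num /ratio_den /scale [u]surjective_pairing [v]surjective_pairing.
split; congr (_, _) => /=; rewrite ?ud1 ?ud2 ?v1 ?v2 bE; field.
all: by rewrite x1' y1' l23.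
Qed.

Lemma ratios_sym x y u v : x != 0 -> y != 0 -> ratios x y u v ->
  ratios x^-1 y^-1 v u.
Proof.
move=> x0 y0 [uv u1 u2 u3]; split=> //; first by rewrite br_neq0C.
  by rewrite u2 mulKf.
by rewrite u3 mulKf.
Qed.

(** If [v] vanished at one of the roots, so would [u], and the two would be proportional. *)
Lemma ratios_neq0 x y u v : ratios x y u v ->
  [/\ br v l1 != 0, br v l2 != 0 & br v l3 != 0].
Proof.
move=> [uv u1 u2 u3].
have ne l c : l != 0 -> br u l = c * br v l -> br v l != 0.
  move=> l0 ul; apply: contraNneq uv => vl; apply/eqP/(br_trans l0) => //.
  by rewrite ul vl mulr0.
split; [apply: (ne l1 1)|apply: (ne l2 x)|apply: (ne l3 y)] => //.
- exact: br_neq0l l12.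
- by rewrite mul1r.
- exact: br_neq0r l12.
exact: br_neq0r l13.
Qed.

Lemma ratios_proportional x y x' y' u v a b : b != 0 ->
  ratios x y u v -> ratios x' y' (scale a u) (scale b v) -> x = x' /\ y = y'.
Proof.
move=> b0 R1 [uv'  + + +]; have [v1 v2 v3] := ratios_neq0 R1.
case: R1 => [uv u1 u2 u3]; rewrite !brZl u1 u2 u3 => /(mulIf v1) ->.
rewrite !(mulrCA _ b) => /(mulfI b0)/(mulIf v2) -> /(mulfI b0)/(mulIf v3) ->.
by [].
Qed.

(** By independence of powers, [u] and [v] are each proportional to [u'] or [v']. In the same order
    the ratios agree; in the opposite order they are inverted. *)
Lemma ratios_pow_inj d x y x' y' u v u' v' c : (3 <= d)%N -> c != 0 ->
    (forall j, (j <= d)%N -> pows d u j - pows d v j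
       = c * (pows d u' j - pows d v' j)) ->
    x != 0 -> y != 0 ->
    ratios x y u v -> ratios x' y' u' v' ->
  (x = x' /\ y = y') \/ (x^-1 = x' /\ y^-1 = y').
Proof.
move=> d3 c0 E x0 y0 R1 R2; have [uv _ _ _] := R1; have [u'v' _ _ _] := R2.
have u0 := br_neq0l uv; have v0 := br_neq0r uv.
have u'0 := br_neq0l u'v'; have v'0 := br_neq0r u'v'.
have uP : (br u' u == 0) || (br v' u == 0).
  (* Otherwise u^d = v^d + c u'^d - c v'^d would be a relation excluded by [pows_indep]. *)
  apply: contraT; rewrite negb_or ![br _ u]brC !oppr_eq0 => /andP[uu' uv'].
  case/eqP: (oner_neq0 K); apply: (@pows_indep _ d u v u' v' 1 1 c (- c)) => // j jd.
  by move: (E j jd) => /eqP; rewrite subr_eq => /eqP; rewrite !mul1r => ->; ring.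
have vP : (br u' v == 0) || (br v' v == 0).
  apply: contraT; rewrite negb_or ![br _ v]brC !oppr_eq0 => /andP[vu' vv'].
  case/eqP: (oner_neq0 K).
  apply: (@pows_indep _ d v u u' v' 1 1 (- c) c) => //; first by rewrite br_neq0C.
  move=> j jd; move: (E j jd) => /eqP; rewrite subr_eq => /eqP; rewrite !mul1r => ->.
  by ring.
have vu : br v u != 0 by rewrite br_neq0C.
have [uu'|uu'] /= := boolP (br u' u == 0); last first.
  move: uP; rewrite (negPf uu') /= => /(br_eq0P _ u0)[b Eb].
  have v'v : br v' v != 0 by rewrite Eb brZl mulf_neq0 //;
    apply: contraNneq v'0 => b0; rewrite Eb b0 /scale !mul0r.
  move: vP; rewrite (negPf v'v) orbF => /(br_eq0P _ v0)[a Ea].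
  right; move: R2; rewrite Ea Eb => R2.
  apply: (ratios_proportional _ (ratios_sym x0 y0 R1) R2).
  by apply: contraNneq v'0 => b0; rewrite Eb b0 /scale !mul0r.
left; have /(br_eq0P _ u0)[a Ea] := uu'.
have a0 : a != 0 by apply: contraNneq u'0 => a0; rewrite Ea a0 /scale !mul0r.
move: vP; rewrite {1}Ea brZl mulf_eq0 (negPf a0) (negPf uv) /= => /(br_eq0P _ v0)[b Eb].
move: R2; rewrite Ea Eb => R2; apply: (ratios_proportional _ R1 R2).
by apply: contraNneq v'0 => b0; rewrite Eb b0 /scale !mul0r.
Qed.

End RatiosAtThreePoints.

(** * Points of a projective space and their representatives *)

Section ProjectivePoints.
Variables (K : fieldType) (V : vectType K).
Implicit Types (p q : proj V) (v : V).

Lemma line_vline p v : v != 0 -> v \in line p -> line p = <[v]>%VS.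
Proof.
move=> v0 vp; apply/esym/eqP; rewrite eqEdim -memvE vp.
by rewrite (eqP (valP p)) dim_vline v0.
Qed.

Lemma proj_eq p q v : v != 0 -> v \in line p -> v \in line q -> p = q.
Proof. move=> v0 vp vq; apply: val_inj.
by rewrite /= (line_vline v0 vp) (line_vline v0 vq). Qed.

Lemma mem_lineP p v : reflect (exists c, v = c *: rep p) (v \in line p).
Proof.
rewrite (line_vline (rep_neq0 p) (mem_rep p)).
by apply: (iffP (vlineP _ _)) => -[c]; exists c.
Qed.

Lemma rep_scale p v : v != 0 -> v \in line p ->
  exists2 c, c != 0 & rep p = c *: v.
Proof.
move=> v0 vp; have := mem_rep p; rewrite (line_vline v0 vp) => /vlineP[c rE].
by exists c => //; apply: contraNneq (rep_neq0 p) => c0; rewrite rE c0 scale0r.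
Qed.

Lemma mem_point v (v0 : v != 0) : v \in line (Defs.point v0).
Proof. exact: memv_line. Qed.

End ProjectivePoints.

(** * Waring rank two *)

Section SumsOfTwoPowers.
Variables (R : realType) (n : nat).
Local Notation K := R[i].
Local Notation d := n.+4.
Implicit Types (u v w : K * K) (F : Defs.form R d) (p : pform R d) (q : pform R 1).

Definition lform u : Defs.form R 1 := DHomog (linear_form_homog u).

Lemma lform_eq0 u : (lform u == 0) = (u == 0).
Proof.
apply/eqP/eqP => [/(congr1 val)|->]; last first.
  by apply: val_inj; rewrite /= /linear_form !scale0r addr0.
by rewrite /= => E; apply: linear_form_inj; rewrite E /linear_form !scale0r addr0.
Qed.

Lemma lformP (L : Defs.form R 1) : exists u, L = lform u.
Proof.
have [u E] := linear_formP (dhomog_is_dhomog L).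
by exists u; apply: val_inj.
Qed.

Lemma rep_lform q : exists2 u, u != 0 & rep q = lform u.
Proof.
by have [u E] := lformP (rep q); exists u => //; rewrite -lform_eq0 -E rep_neq0.
Qed.

Lemma form_pow_lformZ c u :
  form_pow d (lform (scale c u)) = c ^+ d *: form_pow d (lform u).
Proof. by apply: val_inj; rewrite /= linear_formZ exprZn. Qed.

Lemma cf_form_pow u j : (j <= d)%N -> cf d (val (form_pow d (lform u))) j = pows d u j.
Proof. exact: cf_linear_pow. Qed.

Lemma cf_form_lin a b F G j : cf d (val (a *: F + b *: G)) j
  = a * cf d (val F) j + b * cf d (val G) j.
Proof. by rewrite -!cfZ -cfD. Qed.

Lemma form_eqP F G : (forall j, (j <= d)%N -> cf d (val F) j = cf d (val G) j) -> F = G.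
Proof.
move=> FG; apply: val_inj; rewrite /= (mformK (dhomog_is_dhomog F)).
by rewrite (mformK (dhomog_is_dhomog G)); apply: eq_mform.
Qed.

Definition power_difference u v : Defs.form R d :=
  form_pow d (lform u) - form_pow d (lform v).

(** Independence forces [w] to be proportional to both [u] and [v], hence zero; then u^d = v^d,
    which independence excludes again. *)
Lemma power_difference_not_power u v w a : br u v != 0 ->
  power_difference u v <> a *: form_pow d (lform w).
Proof.
move=> uv /(congr1 val) /= E.
have {}E j : (j <= d)%N -> pows d u j = pows d v j + a * pows d w j.
  by move=> jd; rewrite -!cf_linear_pow // -cfZ -E cfB addrC subrK.
have vu : br v u != 0 by rewrite br_neq0C.
have u0 := br_neq0l uv; have v0 := br_neq0r uv.
have uw : br u w = 0.
  apply/eqP/contraT => uw; case/eqP: (oner_neq0 K).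
  (* The relation has only three terms; [w] is repeated with coefficient 0 as the fourth. *)
  apply: (@pows_indep _ d u v w w 1 1 a 0) => // j jd.
  by rewrite mul0r addr0 !mul1r E.
have vw : br v w = 0.
  apply/eqP/contraT => vw; case/eqP: (oner_neq0 K).
  apply: (@pows_indep _ d v u w w 1 1 (- a) 0) => // j jd.
  by rewrite mul0r addr0 !mul1r E // mulNr addrK.
have w0 : w = 0 by apply: (br_two_eq0 uv); rewrite brC (uw, vw) oppr0.
case/eqP: (oner_neq0 K).
apply: (@pows_indep _ d u v v v 1 1 0 0) => // j jd.
rewrite !mul0r !addr0 !mul1r E // w0 /pows /=.
by rewrite -exprD subnKC // expr0n mulr0 addr0.
Qed.

Lemma power_difference_neq0 u v : br u v != 0 -> power_difference u v != 0.
Proof.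
move=> uv; apply/eqP => E.
by apply: (@power_difference_not_power u v 0 0) => //; rewrite scale0r.
Qed.

(** A normal form for rank two: over the complex numbers the coefficients of the two powers can be
    absorbed into the linear forms. *)
Definition is_power_difference u v p :=
  br u v != 0 /\ power_difference u v \in line p.

Lemma power_difference_rep u v p : is_power_difference u v p ->
  exists2 c, c != 0 & rep p = c *: power_difference u v.
Proof. by case=> uv; apply: rep_scale; apply: power_difference_neq0. Qed.

Lemma sum_two_powers u v a b p : br u v != 0 -> a != 0 -> b != 0 ->
    rep p = a *: form_pow d (lform u) + b *: form_pow d (lform v) ->
  exists u' v', is_power_difference u' v' p.
Proof.
move=> uv a0 b0 E.
exists (scale (d.-root a) u), (scale (d.-root (- b)) v); split.
  by rewrite brZl brZr !mulf_neq0 // rootC_eq0 // oppr_eq0.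
rewrite /power_difference !form_pow_lformZ !rootCK // scaleNr opprK -E.
exact: mem_rep.
Qed.

Lemma mem_veronese q u : lform u \in line q -> form_pow d (lform u) \in line (veronese d q).
Proof.
move=> /mem_lineP[c E]; have := mem_point (form_pow_neq0 d (rep_neq0 q)).
rewrite -/(veronese d q) => H; rewrite (_ : form_pow d _ = c ^+ d *: form_pow d (rep q)).
  exact: memvZ.
by apply: val_inj; rewrite /= -exprZn; congr (_ ^+ _); rewrite -[LHS]/(val (lform u)) E.
Qed.

Lemma veronese_rep q : exists2 u, u != 0 &
  rep q = lform u /\ line (veronese d q) = <[form_pow d (lform u)]>%VS.
Proof.
have [u u0 E] := rep_lform q; exists u => //; split=> //.
apply: line_vline; first by rewrite form_pow_neq0 // lform_eq0.
by apply: mem_veronese; rewrite -E mem_rep.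
Qed.

(** On a secant line, a point off the curve has both coefficients nonzero, so roots can be
    extracted. Conversely, a difference of independent powers is not a power. *)
Lemma secant_not_curveP p :
  (secant_union R d `\` rational_normal_curve R d)%classic p <->
  exists u v, is_power_difference u v p.
Proof.
split=> [[[_ [_ [[qa _ <-] [qb _ <-] ab pab]]] pC]|[u [v pd]]].
  have [u u0 [Ea la]] := veronese_rep qa; have [v v0 [Eb lb]] := veronese_rep qb.
  have : rep p \in (line (veronese d qa) + line (veronese d qb))%VS.
    exact: (subvP pab) (mem_rep p).
  rewrite la lb => /memv_addP[_ /vlineP[a ->] [_ /vlineP[b ->] E]].
  apply: (sum_two_powers _ _ _ E).
  - apply/negP => /(br_eq0P _ v0)[c uc]; apply: ab.
    apply: (@proj_eq _ _ _ _ (form_pow d (lform u))).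
    + by rewrite form_pow_neq0 // lform_eq0.
    + by rewrite la memv_line.
    + by rewrite lb uc form_pow_lformZ memvZ // memv_line.
  - apply/eqP => a0; apply: pC; exists qb => //.
    apply: (@proj_eq _ _ _ _ (rep p)); rewrite ?rep_neq0 ?mem_rep //.
    by rewrite E a0 scale0r add0r lb memvZ // memv_line.
  - apply/eqP => b0; apply: pC; exists qa => //.
    apply: (@proj_eq _ _ _ _ (rep p)); rewrite ?rep_neq0 ?mem_rep //.
    by rewrite E b0 scale0r addr0 la memvZ // memv_line.
have [uv pE] := pd; have [c c0 E] := power_difference_rep pd.
have u0 : lform u != 0 by rewrite lform_eq0 (br_neq0l uv).
have v0 : lform v != 0 by rewrite lform_eq0 (br_neq0r uv).
have ua := mem_veronese (mem_point u0); have vb := mem_veronese (mem_point v0).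
split.
  exists (veronese d (Defs.point u0)), (veronese d (Defs.point v0)); split.
  - by exists (Defs.point u0).
  - by exists (Defs.point v0).
  - move=> ab; have := vb; rewrite -ab.
    rewrite (line_vline _ ua) ?form_pow_neq0 // => /vlineP[b vE].
    apply: (@power_difference_not_power u v u (1 - b) uv).
    by rewrite /power_difference vE scalerBl scale1r.
  rewrite (line_vline (power_difference_neq0 uv) pE) -memvE.
  by rewrite memv_add ?memvN.
move=> [q _ qp]; have [w w0 [_ lw]] := veronese_rep q.
move: pE; rewrite -qp lw => /vlineP[a].
exact: power_difference_not_power.
Qed.

Lemma waring_sum0 F : waring_sum F 0 -> F = 0.
Proof. by move=> [a [L E]]; apply: val_inj; rewrite [LHS]E big_ord0. Qed.

Lemma waring_sum1P F :
  waring_sum F 1 <-> exists a u, F = a *: form_pow d (lform u).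
Proof.
split=> [[a [L E]]|[a [u ->]]]; last first.
  by exists (fun=> a), (fun=> lform u); rewrite big_ord1.
have [u uE] := lformP (L ord0); exists (a ord0), u.
by apply: val_inj; rewrite [LHS]E big_ord1 uE.
Qed.

Lemma waring_sum2P F : waring_sum F 2 <-> exists a b u v,
  F = a *: form_pow d (lform u) + b *: form_pow d (lform v).
Proof.
split=> [[a [L E]]|[a [b [u [v ->]]]]].
  have [u uE] := lformP (L ord0); have [v vE] := lformP (L ord_max).
  exists (a ord0), (a ord_max), u, v.
  apply: val_inj; rewrite [LHS]E big_ord_recl big_ord1 uE.
  have -> : lift ord0 ord0 = ord_max :> 'I_2 by apply: val_inj.
  by rewrite vE.
exists (fun i => if i == ord0 then a else b).
exists (fun i => if i == ord0 then lform u else lform v).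
by rewrite big_ord_recl big_ord1.
Qed.

(** In a minimal sum the coefficients are nonzero and the linear forms independent, since otherwise
    one power would suffice. *)
Lemma waring_rank2P p : pwaring_rank p 2 <-> exists u v, is_power_difference u v p.
Proof.
split=> [[/waring_sum2P[a [b [u [v E]]]] rk]|[u [v pd]]].
  have {rk}no c w : rep p <> c *: form_pow d (lform w).
    by move=> cw; have /rk : waring_sum (rep p) 1 by apply/waring_sum1P; exists c, w.
  apply: (sum_two_powers _ _ _ E).
  - have [v0|v0] := eqVneq v 0.
      case: (no a u); have v0E : v = scale 0 v by rewrite v0 /scale !mul0r.
      by rewrite E v0E form_pow_lformZ expr0n scale0r scaler0 addr0.
    apply/negP => /(br_eq0P _ v0)[c uc]; apply: (no (a * c ^+ d + b) v).
    by rewrite E uc form_pow_lformZ scalerA -scalerDl.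
  - by apply/eqP => a0; apply: (no b v); rewrite E a0 scale0r add0r.
  by apply/eqP => a0; apply: (no a u); rewrite E a0 scale0r addr0.
have [uv pE] := pd; have [c c0 E] := power_difference_rep pd.
rewrite /pwaring_rank E; split.
  apply/waring_sum2P; exists c, (- c), u, v.
  by rewrite /power_difference scalerBr scaleNr.
case=> [|[|//]].
  by move/waring_sum0/eqP; rewrite scaler_eq0 (negPf c0) (negPf (power_difference_neq0 uv)).
move=> /waring_sum1P[a [w /(congr1 ( *:%R c^-1))]]; rewrite !scalerA mulVf // scale1r.
by move=> /(power_difference_not_power uv).
Qed.

End SumsOfTwoPowers.

(** * Determinants of linear forms and Hankel minors of sums of powers *)

Lemma det_homog (K : comNzRingType) k (A : 'M[{mpoly K[k]}]_3) :
  (forall i j, A i j \is 1.-homog) -> \det A \is 3.-homog.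
Proof.
move=> A1; apply: rpred_sum => s _.
have P : \prod_i A i (s i) \is 3.-homog.
  rewrite !big_ord_recl big_ord0 mulr1.
  by apply: (@dhomogM _ _ _ 1 _ 2) => //; apply: (@dhomogM _ _ _ 1 _ 1).
by rewrite mulr_sign; case: (odd_perm s); rewrite ?dhomogN.
Qed.

(** The composite of the shifts by [u] and [v] kills the sequence, so its three coefficients give a
    dependence between the columns. *)
Lemma hankel_minor_pows (K : numClosedFieldType) n (u v : K * K) a b s :
    u != 0 -> v != 0 ->
    (forall j, (j <= n.+2)%N -> s j = a * pows n.+2 u j + b * pows n.+2 v j) ->
  forall f : 'I_3 -> 'I_n.+1, hankel_minor s f = 0.
Proof.
move=> u0 v0 sE f; rewrite /hankel_minor -det_tr; apply/eqP/det0P.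
pose c : 'rV[K]_3 := \row_(j < 3) (if j == 0 then u.1 * v.1 else
  if j == 1 then - (u.2 * v.1 + u.1 * v.2) else u.2 * v.2).
exists c.
  have cP j : c 0 j != 0 -> c != 0 by apply: contraNneq => ->; rewrite mxE.
  move: u0 v0; rewrite !pair_neq0.
  have [u1|u1] := eqVneq u.1 0; have [v1|v1] := eqVneq v.1 0 => //= u0 v0.
  - by apply: (cP 2%:R); rewrite mxE /= mulf_neq0.
  - by apply: (cP 1); rewrite mxE /= u1 mul0r addr0 oppr_eq0 mulf_neq0.
  - by apply: (cP 1); rewrite mxE /= v1 mulr0 add0r oppr_eq0 mulf_neq0.
  by apply: (cP 0); rewrite mxE /= mulf_neq0.
apply/rowP => i; rewrite !mxE !big_ord_recl big_ord0 !mxE /= addn0.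
move: (ltn_ord (f i)); move: (nat_of_ord (f i)) => j jn.
rewrite /bump /= !addn1 addn2; transitivity (shift u (shift v s) j).
  by rewrite /shift; ring.
have E w : shift u (shift v (pows n.+2 w)) j = br w u * br w v * pows n w j.
  have S1 k : (k <= n.+1)%N -> shift v (pows n.+2 w) k = br w v * pows n.+1 w k.
    exact: shift_pows.
  by rewrite (eq_shiftZ _ S1) // shift_pows //; ring.
transitivity (a * shift u (shift v (pows n.+2 u)) j
            + b * shift u (shift v (pows n.+2 v)) j).
  have jn1 : (j.+1 <= n.+2)%N by apply: leq_trans jn _.
  by rewrite /shift !sE ?(ltnW jn1) //; ring.
by rewrite !E !bruu; ring.
Qed.

(** * The catalecticant equations *)

Section Closure.
Variables (R : realType) (n : nat).
Local Notation K := R[i].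
Local Notation d := n.+4.
Implicit Types (u v w : K * K) (F : Defs.form R d) (p : pform R d) (q : pform R 1).

Definition catalecticant_locus : set (pform R d) :=
  [set p | forall (f : 'I_3 -> 'I_n.+3) F, F \in line p -> hankel_minor (cf d (val F)) f = 0]%classic.

(** The function [cf d _ j] as a linear polynomial in the coordinates used by [zeros], which makes
    the Hankel minors cubic polynomials in them. *)
Definition coord_cf j : {mpoly K[\dim {: Defs.form R d}]} :=
  \sum_(i < \dim {: Defs.form R d}) cf d (val (vbasis {: Defs.form R d})`_i) j *: 'X_i.

Lemma meval_coord_cf F j :
  (coord_cf j).@[fun i => coord (vbasis {: Defs.form R d}) i F] = cf d (val F) j.
Proof.
rewrite raddf_sum /= [in RHS](coord_vbasis (memvf F)).
rewrite raddf_sum /cf raddf_sum /= mulr_suml; apply: eq_bigr => i _.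
by rewrite mevalZ mevalXU mcoeffZ mulrC mulrA.
Qed.

Lemma coord_cf_homog j : coord_cf j \is 1.-homog.
Proof.
by apply: rpred_sum => i _; apply: dhomogZ; rewrite dhomogX [X in X == _]mdeg1.
Qed.

Lemma catalecticant_closed : zariski_closed catalecticant_locus.
Proof.
pose M (f : 'I_3 -> 'I_n.+3) := \det (\matrix_(i < 3, j < 3) coord_cf (f i + j)%N).
have ME f F : (M f).@[fun i => coord (vbasis {: Defs.form R d}) i F]
    = hankel_minor (cf d (val F)) f.
  rewrite -det_map_mx; congr (\det _); apply/matrixP => i j.
  by rewrite !mxE; apply: meval_coord_cf.
exists (range M); split=> [_ [f _ <-]|].
  by exists 3%N; apply: det_homog => i j; rewrite mxE coord_cf_homog.
apply/seteqP; split=> p pM.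
  by move=> _ [f _ <-] F Fp; rewrite ME pM.
by move=> f F Fp; rewrite -ME; apply: pM => //; exists f.
Qed.

Lemma secant_catalecticant : (secant_union R d `<=` catalecticant_locus)%classic.
Proof.
move=> p [_ [_ [[qa _ <-] [qb _ <-] _ pab]]] f F Fp.
have [u u0 [_ la]] := veronese_rep n qa; have [v v0 [_ lb]] := veronese_rep n qb.
have : F \in (line (veronese d qa) + line (veronese d qb))%VS by apply: subvP pab _ Fp.
rewrite la lb => /memv_addP[_ /vlineP[a ->] [_ /vlineP[b ->] ->]].
apply: (hankel_minor_pows (a := a) (b := b) u0 v0) => j jd.
by rewrite cf_form_lin; congr (_ * _ + _ * _); apply: cf_form_pow jd.
Qed.

Lemma closure_catalecticant :
  (zariski_closure (secant_union R d) `<=` catalecticant_locus)%classic.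
Proof.
exact: smallest_sub catalecticant_closed secant_catalecticant.
Qed.

End Closure.

(** * Forms divisible by three distinct linear forms *)

Section Multiples.
Variables (R : realType) (n : nat).
Local Notation K := R[i].
Local Notation d := n.+4.
Implicit Types (u v w l : K * K) (F : Defs.form R d) (p : pform R d) (q : pform R 1).

Definition multiple l1 l2 l3 p :=
  exists G : {mpoly K[2]}, val (rep p) = G * triple_product l1 l2 l3.

Lemma multiple_scale c1 c2 c3 l1 l2 l3 p : c1 != 0 -> c2 != 0 -> c3 != 0 ->
  multiple (scale c1 l1) (scale c2 l2) (scale c3 l3) p <-> multiple l1 l2 l3 p.
Proof.
by move=> n1 n2 n3; rewrite /multiple triple_productZ; apply: dvd_scale; rewrite !mulf_neq0.
Qed.

Lemma triple_multiplesE q1 q2 q3 l1 l2 l3 :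
    rep q1 = lform l1 -> rep q2 = lform l2 -> rep q3 = lform l3 ->
  forall p, triple_multiples [tuple q1; q2; q3] p <-> multiple l1 l2 l3 p.
Proof.
move=> E1 E2 E3 p; rewrite /triple_multiples /multiple /=.
by rewrite !big_cons big_nil mulr1 E1 E2 E3.
Qed.

Lemma uniq_triple_lforms (L : 3.-tuple (pform R 1)) : uniq L ->
  exists l1 l2 l3, [/\ br l1 l2 != 0, br l1 l3 != 0, br l2 l3 != 0 &
    forall p, triple_multiples L p <-> multiple l1 l2 l3 p].
Proof.
case/tupleP: L => q1 L; case/tupleP: L => q2 L; case/tupleP: L => q3 L.
rewrite (tuple0 L) => /= /and3P[]; rewrite !inE negb_or => /andP[q12 q13] q23 _.
have [l1 l10 E1] := rep_lform q1; have [l2 l20 E2] := rep_lform q2.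
have [l3 l30 E3] := rep_lform q3.
have brq q q' l l' : q != q' -> l' != 0 -> l != 0 -> rep q = lform l -> rep q' = lform l' ->
    br l l' != 0.
  move=> qq' l'0 l0 E E'; apply: contraNN qq' => /(br_eq0P _ l'0)[c lE]; apply/eqP.
  apply: (@proj_eq _ _ _ _ (lform l)); first by rewrite lform_eq0.
    by rewrite -E mem_rep.
  apply/mem_lineP; exists c; rewrite E' lE.
  by apply: val_inj; rewrite /= linear_formZ.
exists l1, l2, l3; split; [exact: (brq q1 q2)|exact: (brq q1 q3)|exact: (brq q2 q3)|].
move=> p; rewrite -(triple_multiplesE E1 E2 E3).
by rewrite (_ : [tuple of _] = [tuple q1; q2; q3]) //; apply: val_inj.
Qed.

(** The chosen representatives of the three points differ from the given forms by nonzero scalars,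
    which do not affect divisibility. *)
Lemma lforms_triple l1 l2 l3 :
    br l1 l2 != 0 -> br l1 l3 != 0 -> br l2 l3 != 0 ->
  exists2 L : 3.-tuple (pform R 1), uniq L &
    forall p, triple_multiples L p <-> multiple l1 l2 l3 p.
Proof.
move=> l12 l13 l23.
have ex l : l != 0 -> exists q c, [/\ c != 0, rep q = lform (scale c l) & lform l \in line q].
  rewrite -lform_eq0 => l0; have [c c0 E] := rep_scale l0 (mem_point l0).
  exists (Defs.point l0), c; split=> //; last exact: mem_point.
  by rewrite E; apply: val_inj; rewrite /= linear_formZ.
have [q1 [c1 [n1 E1 m1]]] := ex l1 (br_neq0l l12).
have [q2 [c2 [n2 E2 m2]]] := ex l2 (br_neq0r l12).
have [q3 [c3 [n3 E3 m3]]] := ex l3 (br_neq0r l13).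
have neq l l' q q' : br l l' != 0 -> lform l \in line q -> lform l' \in line q' -> q != q'.
  move=> ll' lq lq'; apply: contraNneq ll' => qq'; rewrite -qq' in lq'.
  have [x xE] := mem_lineP _ _ lq; have [y yE] := mem_lineP _ _ lq'.
  have [w wE] := lformP (rep q).
  have sE t m : lform m = t *: rep q -> m = scale t w.
    rewrite wE => /(congr1 val) /= mE.
    by apply: linear_form_inj; rewrite linear_formZ.
  by rewrite (sE _ _ xE) (sE _ _ yE) brZl brZr bruu !mulr0.
exists [tuple q1; q2; q3].
  rewrite /= !inE negb_or !andbT.
  by rewrite (neq _ _ _ _ l12 m1 m2) (neq _ _ _ _ l13 m1 m3) (neq _ _ _ _ l23 m2 m3).
by move=> p; rewrite (triple_multiplesE E1 E2 E3) multiple_scale.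
Qed.

Lemma multiple_root l1 l2 l3 p l : multiple l1 l2 l3 p -> l \in [:: l1; l2; l3] ->
  (val (rep p)).@[vec (perp l)] = 0.
Proof.
move=> [G ->]; rewrite !inE !mevalM !meval_perp => /or3P[]/eqP->.
- by rewrite bruu mul0r mulr0.
- by rewrite bruu mul0r !mulr0.
by rewrite bruu !mulr0.
Qed.

Lemma meval_form_pow u l :
  (val (form_pow d (lform u))).@[vec (perp l)] = br u l ^+ d.
Proof. by rewrite rmorphXn /= meval_perp. Qed.

Lemma meval_lin a b F G (x : 'I_2 -> K) : (val (a *: F + b *: G)).@[x]
  = a * (val F).@[x] + b * (val G).@[x].
Proof. by rewrite -!mevalZ -mevalD. Qed.

Lemma meval_power_difference c u v l :
  (val (c *: power_difference n u v)).@[vec (perp l)] = c * (br u l ^+ d - br v l ^+ d).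
Proof. by rewrite -[br u l ^+ d]meval_form_pow -[br v l ^+ d]meval_form_pow -mevalB -mevalZ. Qed.

Section FixedTriple.
Variables (l1 l2 l3 : K * K).
Hypotheses (l12 : br l1 l2 != 0) (l13 : br l1 l3 != 0) (l23 : br l2 l3 != 0).

Lemma power_not_multiple p a u :
  rep p = a *: form_pow d (lform u) -> ~ multiple l1 l2 l3 p.
Proof.
move=> E mul; have au : a *: form_pow d (lform u) != 0 by rewrite -E rep_neq0.
have a0 : a != 0 by apply: contraNneq au => ->; rewrite scale0r.
have root l : l \in [:: l1; l2; l3] -> br u l = 0.
  move=> /(multiple_root mul)/eqP; rewrite E -[_ *: _]addr0 -(scale0r 0) meval_lin.
  by rewrite mul0r addr0 meval_form_pow mulf_eq0 (negPf a0) expf_eq0 => /eqP.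
have u0 : u = 0 by apply: (br_two_eq0 l12); apply: root; rewrite !inE eqxx ?orbT.
case/eqP: au; rewrite (_ : u = scale 0 u); last by rewrite u0 /scale !mul0r.
by rewrite form_pow_lformZ expr0n scale0r scaler0.
Qed.

(** Three distinct roots rule out the tangent case of [secant_or_tangent], and also a sum of two
    powers with a zero coefficient, because a power has a single root. *)
Lemma catalecticant_multiple p : catalecticant_locus p -> multiple l1 l2 l3 p ->
  exists u v, is_power_difference u v p.
Proof.
move=> cat mul; have pE := mformK (dhomog_is_dhomog (rep p)).
have r0 : val (rep p) <> 0.
  by move=> E; have := rep_neq0 p; rewrite (_ : rep p = 0) ?eqxx //; apply: val_inj.
have root l : l \in [:: l1; l2; l3] -> (mform d (cf d (val (rep p)))).@[vec (perp l)] = 0.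
  by move=> ll; rewrite -pE; apply: multiple_root mul ll.
have := @secant_or_tangent _ n.+2 (cf d (val (rep p))) (fun f => cat f _ (mem_rep p)).
case=> [[u [v [a [b [uv E]]]]]|[u u0 [m E]]]; last first.
  case: r0; rewrite [LHS]pE (eq_mform E); apply: tangent_three_roots l12 l13 l23 _ => //.
  by move=> l ll; rewrite -(eq_mform E) root.
have {}E : rep p = a *: form_pow d (lform u) + b *: form_pow d (lform v).
  apply: form_eqP => j jd; rewrite cf_form_lin E //.
  by congr (_ * _ + _ * _); apply/esym/cf_form_pow.
apply: (sum_two_powers uv _ _ E); apply/eqP => z0.
  by apply: (@power_not_multiple p b v) mul; rewrite E z0 scale0r add0r.
by apply: (@power_not_multiple p a u) mul; rewrite E z0 scale0r addr0.
Qed.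

Lemma multiple_power_difference p u v l : multiple l1 l2 l3 p ->
    is_power_difference u v p -> l \in [:: l1; l2; l3] ->
  br u l ^+ d = br v l ^+ d.
Proof.
move=> mul pd ll; have [c c0 E] := power_difference_rep pd.
move: (multiple_root mul ll); rewrite E meval_power_difference => /eqP.
by rewrite mulf_eq0 (negPf c0) subr_eq0 => /eqP.
Qed.

Variable z : K.
Hypothesis z_prim : d.-primitive_root z.

Lemma ratio_root p u v l : l != 0 -> br u v != 0 -> br u l ^+ d = br v l ^+ d ->
  exists2 w, w ^+ d = 1 & br u l = w * br v l.
Proof.
move=> l0 uv E.
have vl : br v l != 0.
  apply: contraNneq uv => vl; move: E; rewrite vl expr0n /= => /eqP.
  by rewrite expf_eq0 => /eqP ul; apply/eqP/(br_trans l0).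
exists (br u l / br v l); last by rewrite divfK.
by rewrite expr_div_n E divff // expf_neq0.
Qed.

Lemma ratios_multiple p x y u v : x ^+ d = 1 -> y ^+ d = 1 ->
    ratios l1 l2 l3 x y u v -> is_power_difference u v p -> multiple l1 l2 l3 p.
Proof.
move=> xd yd [uv u1 u2 u3] pd; have [c c0 E] := power_difference_rep pd.
have [i xE] := prim_rootP z_prim xd; have [j yE] := prim_rootP z_prim yd.
have [G GE] : exists G, linear_form u ^+ d - linear_form v ^+ d = G * triple_product l1 l2 l3.
  apply: (@three_roots_dvd _ d z ord0 i j) => //; rewrite -?xE -?yE //.
  by rewrite expr0 mul1r.
by exists (c *: G); rewrite E -scalerAl -GE.
Qed.

End FixedTriple.
End Multiples.

(** A ratio s taken at two distinct points would make the nonzero form u - s v vanish at both. *)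
Lemma ratios_neq1 (K : numClosedFieldType) (l1 l2 l3 u v : K * K) (x y : K) :
    br l1 l2 != 0 -> br l1 l3 != 0 -> br l2 l3 != 0 -> ratios l1 l2 l3 x y u v ->
  [/\ x != 1, y != 1 & x != y].
Proof.
move=> l12 l13 l23 [uv u1 u2 u3].
have neq l m (s t : K) : br l m != 0 -> br u l = s * br v l -> br u m = t * br v m -> s != t.
  move=> lm ul um; apply: contraNneq (sub_scale_neq0 s uv) => st.
  by apply/eqP/(br_two_eq0 lm); rewrite brBl brZl (ul, um) ?st subrr.
split; first by rewrite eq_sym; apply: neq l12 _ u2; rewrite mul1r.
  by rewrite eq_sym; apply: neq l13 _ u3; rewrite mul1r.
exact: neq l23 u2 u3.
Qed.

(** * Counting the multiples of rank two *)

Section Counting.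
Variables (R : realType) (n : nat).
Local Notation K := R[i].
Local Notation d := n.+4.
Variables (l1 l2 l3 : K * K).
Hypotheses (l12 : br l1 l2 != 0) (l13 : br l1 l3 != 0) (l23 : br l2 l3 != 0).
Variable z : K.
Hypothesis z_prim : d.-primitive_root z.
Implicit Types (u v w l : K * K) (F : Defs.form R d) (p : pform R d) (q : pform R 1).

Lemma power_differenceC u v : power_difference n v u = - power_difference n u v.
Proof. by rewrite /power_difference opprB. Qed.

Lemma power_differenceZ c u v :
  power_difference n (scale c u) (scale c v) = c ^+ d *: power_difference n u v.
Proof. by rewrite /power_difference !form_pow_lformZ [RHS]scalerBr. Qed.

Lemma cf_power_difference c u v j : (j <= d)%N ->
  cf d (val (c *: power_difference n u v)) j = c * (pows d u j - pows d v j).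
Proof. by move=> jd; rewrite -!(cf_form_pow _ jd) -cfB -cfZ. Qed.

Lemma is_power_differenceC u v p :
  is_power_difference u v p -> is_power_difference v u p.
Proof.
move=> [uv pE]; split; first by rewrite br_neq0C.
by rewrite power_differenceC rpredN.
Qed.

Lemma unity_root_neq0 (w : K) : w ^+ d = 1 -> w != 0.
Proof. by apply: contra_eqN => /eqP->; rewrite expr0n eq_sym oner_eq0. Qed.

Lemma is_power_difference_scale (w : K) u v p : w ^+ d = 1 ->
  is_power_difference u v p -> is_power_difference u (scale w v) p.
Proof.
move=> wd [uv pE]; split.
  by rewrite brZr mulf_neq0 // unity_root_neq0.
by rewrite /power_difference form_pow_lformZ wd scale1r.
Qed.

Lemma prim_expr_neq i j : (i < j)%N -> (j < d)%N -> z ^+ i != z ^+ j.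
Proof.
move=> ij jd; rewrite (eq_prim_root_expr z_prim) !modn_small ?ltn_eqF //.
exact: ltn_trans ij jd.
Qed.

Lemma prim_expr_neq1 j : (0 < j)%N -> (j < d)%N -> z ^+ j != 1.
Proof. by move=> j0 jd; rewrite eq_sym -(expr0 z) prim_expr_neq. Qed.

Lemma prim_neq0 i : z ^+ i != 0.
Proof. by rewrite expf_neq0 // unity_root_neq0 // (prim_expr_order z_prim). Qed.

Lemma prim_exprV i : (i <= d)%N -> (z ^+ i)^-1 = z ^+ (d - i).
Proof.
move=> id; apply: (mulfI (prim_neq0 i)).
by rewrite divff ?prim_neq0 // -exprD subnKC // (prim_expr_order z_prim).
Qed.

Definition has_ratios i j p := exists u v,
  ratios l1 l2 l3 (z ^+ i) (z ^+ j) u v /\ is_power_difference u v p.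

(** The ratios at the three roots are d-th roots of unity. Rescaling [v] makes the first one 1, and
    exchanging [u] and [v] puts the exponents in increasing order. *)
Lemma multiple_has_ratios p u v : multiple l1 l2 l3 p -> is_power_difference u v p ->
  exists i j, [/\ (0 < i)%N, (i < j)%N, (j < d)%N & has_ratios i j p].
Proof.
move=> mul pd; have [uv _] := pd.
have root l : l \in [:: l1; l2; l3] -> l != 0 -> exists2 w, w ^+ d = 1 & br u l = w * br v l.
  by move=> ll l0; apply: ratio_root => //; apply: multiple_power_difference mul pd ll.
have [||w1 w1d u1] := root l1; rewrite ?inE ?eqxx ?orbT ?(br_neq0l l12) //.
have [||w2 w2d u2] := root l2; rewrite ?inE ?eqxx ?orbT ?(br_neq0r l12) //.
have [||w3 w3d u3] := root l3; rewrite ?inE ?eqxx ?orbT ?(br_neq0r l13) //.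
have w10 := unity_root_neq0 w1d.
have xd : (w2 / w1) ^+ d = 1 by rewrite expr_div_n w2d w1d divr1.
have [i xE] := prim_rootP z_prim xd.
have yd : (w3 / w1) ^+ d = 1 by rewrite expr_div_n w3d w1d divr1.
have [j yE] := prim_rootP z_prim yd.
have {}pd := is_power_difference_scale w1d pd.
have rat : ratios l1 l2 l3 (z ^+ i) (z ^+ j) u (scale w1 v).
  split; first by case: pd.
  - by rewrite brZl.
  - by rewrite brZl -xE mulrA divfK.
  by rewrite brZl -yE mulrA divfK.
have [x1 y1 xy] := ratios_neq1 l12 l13 l23 rat.
have i0 : (0 < i)%N by rewrite lt0n; apply: contraNneq x1 => ->; rewrite expr0.
have j0 : (0 < j)%N by rewrite lt0n; apply: contraNneq y1 => ->; rewrite expr0.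
case: (ltngtP i j) => [ij|ji|ij]; last by rewrite ij eqxx in xy.
  by exists i, j; split=> //; exists u, (scale w1 v).
(* Exchanging [u] and [v] inverts the ratios, which reverses the order of the exponents. *)
exists (d - i)%N, (d - j)%N; split.
- by rewrite subn_gt0.
- by rewrite ltn_sub2l // ltnW.
- by rewrite ltn_subrL j0.
exists (scale w1 v), u; split; last exact: is_power_differenceC.
rewrite -!prim_exprV ?(ltnW (ltn_ord _)) //.
by apply: ratios_sym rat; apply: prim_neq0.
Qed.

(** The ratios fix [u] and [v] up to a common scalar, which only rescales the difference of
    powers. *)
Lemma has_ratios_uniq i j p p' : (0 < i)%N -> (i < j)%N -> (j < d)%N ->
  has_ratios i j p -> has_ratios i j p' -> p = p'.
Proof.
move=> i0 ij jd; have id := ltn_trans ij jd; have j0 := ltn_trans i0 ij.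
have x1 := prim_expr_neq1 i0 id; have y1 := prim_expr_neq1 j0 jd.
have xy := prim_expr_neq ij jd.
set num := ratio_num l1 l2 l3 (z ^+ i) (z ^+ j).
set den := ratio_den l1 l2 l3 (z ^+ i) (z ^+ j).
have [br0 _ _ _] := ratios_exist l12 l13 l23 x1 y1 xy.
have mem r : has_ratios i j r -> power_difference n num den \in line r.
  move=> [u [v [rat [uv]]]]; have [c [uE vE]] := ratios_uniq l12 l23 x1 y1 xy rat.
  have c0 : c != 0 by apply: contraNneq uv => c0; rewrite uE c0 brZl mul0r.
  rewrite uE vE power_differenceZ => /(memvZ (c ^+ d)^-1).
  by rewrite scalerK // expf_neq0.
move=> /mem pE /mem p'E; apply: proj_eq pE p'E.
exact: power_difference_neq0.
Qed.

Lemma has_ratios_exists i j : (0 < i)%N -> (i < j)%N -> (j < d)%N ->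
  exists p, has_ratios i j p.
Proof.
move=> i0 ij jd; have id := ltn_trans ij jd; have j0 := ltn_trans i0 ij.
have rat := ratios_exist l12 l13 l23 (prim_expr_neq1 i0 id) (prim_expr_neq1 j0 jd)
  (prim_expr_neq ij jd).
have [br0 _ _ _] := rat.
exists (Defs.point (power_difference_neq0 n br0)).
exists (ratio_num l1 l2 l3 (z ^+ i) (z ^+ j)), (ratio_den l1 l2 l3 (z ^+ i) (z ^+ j)).
by split=> //; split=> //; apply: mem_point.
Qed.

Lemma has_ratios_inj i j i' j' p : (0 < i)%N -> (i < j)%N -> (j < d)%N ->
    (0 < i')%N -> (i' < j')%N -> (j' < d)%N ->
  has_ratios i j p -> has_ratios i' j' p -> i = i' /\ j = j'.
Proof.
move=> i0 ij jd i0' ij' jd' [u [v [rat pd]]] [u' [v' [rat' pd']]].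
have id := ltn_trans ij jd; have id' := ltn_trans ij' jd'.
have [c c0 E] := power_difference_rep pd; have [c' c'0 E'] := power_difference_rep pd'.
have pE k : (k <= d)%N -> pows d u k - pows d v k = c' / c * (pows d u' k - pows d v' k).
  move=> kd; have e := cf_power_difference c u v kd; rewrite -E in e.
  have e' := cf_power_difference c' u' v' kd; rewrite -E' in e'.
  have := etrans (esym e) e'; move: (pows _ u k - _) (pows _ u' k - _) => a b ab.
  by apply: (mulfI c0); rewrite ab mulrA mulrCA divff // mulr1.
have [] := ratios_pow_inj l12 l13 _ _ pE (prim_neq0 i) (prim_neq0 j) rat rat'.
- by [].
- by rewrite mulf_neq0 ?invr_eq0.
- have inj a b : (a < d)%N -> (b < d)%N -> z ^+ a = z ^+ b -> a = b.
    by move=> ad bd /eqP; rewrite (eq_prim_root_expr z_prim) !modn_small // => /eqP.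
  by move=> [/inj-> // /inj-> //].
have sum a b : (0 < a)%N -> (a < d)%N -> (b < d)%N -> (z ^+ a)^-1 = z ^+ b -> (a + b = d)%N.
  move=> a0 ad bd /eqP; rewrite prim_exprV ?(ltnW ad) // (eq_prim_root_expr z_prim).
  by rewrite !modn_small // ?ltn_subrL ?a0 // => /eqP<-; rewrite subnKC // ltnW.
(* In the exchanged case i + i' = d = j + j', against i < j and i' < j'. *)
move=> [/sum Ei /sum Ej]; have := leq_add ij ij'.
by rewrite addSn addnS Ei // Ej // ?(ltn_trans i0 ij) // ltnNge leqnSn.
Qed.

Lemma card_multiples :
  ([set p : pform R d | pwaring_rank p 2 /\ multiple l1 l2 l3 p]%classic
     #= `I_'C(n.+3, 2))%card.
Proof.
pose T := [set t : 2.-tuple 'I_n.+3 | sorted ltn (map val t)]%SET.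
have cardT : #|T| = 'C(n.+3, 2) by apply: card_ltn_sorted_tuples.
(* Exponents range over 1..d-1 and ordinals start at 0, so entries are raised by one. *)
pose fst_ (k : 'I_#|T|) := (tnth (enum_val k) ord0).+1.
pose snd_ (k : 'I_#|T|) := (tnth (enum_val k) ord_max).+1.
have fsP k : (fst_ k < snd_ k < d)%N.
  have := enum_valP k; rewrite inE /fst_ /snd_; case/tupleP: (enum_val k) => a t.
  case/tupleP: t => b t; rewrite (tuple0 t) /= !(tnth_nth a) /= andbT !ltnS => ab.
  by rewrite ab -ltnS ltn_ord.
have fst0 k : (0 < fst_ k)%N by [].
have ex (k : 'I_#|T|) : exists p, has_ratios (fst_ k) (snd_ k) p.
  by case/andP: (fsP k) => ab bd; apply: has_ratios_exists.
have [f fP] := choice ex.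
have f_inj : injective f.
  move=> k k' fkk'; case/andP: (fsP k) => ab bd; case/andP: (fsP k') => ab' bd'.
  have fP' := fP k'; rewrite -fkk' in fP'.
  have [e1 e2] := has_ratios_inj (fst0 k) ab bd (fst0 k') ab' bd' (fP k) fP'.
  apply: enum_val_inj; apply: eq_from_tnth => i.
  case: i => [[|[|//]] ib]; apply: val_inj.
    by rewrite (_ : Ordinal ib = ord0); [case: e1|apply: val_inj].
  by rewrite (_ : Ordinal ib = ord_max); [case: e2|apply: val_inj].
rewrite (_ : mkset _ = range f); last first.
  apply/seteqP; split=> [p [/waring_rank2P[u [v pd]] mul]|_ [k _ <-]].
    have [i [j [i0 ij jd ijp]]] := multiple_has_ratios mul pd.
    have ai : (i.-1 < n.+3)%N by rewrite -ltnS prednK // (ltn_trans ij).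
    have bj : (j.-1 < n.+3)%N by rewrite -ltnS prednK // (ltn_trans i0).
    have tT : [tuple Ordinal ai; Ordinal bj] \in T.
      rewrite inE /= andbT -ltnS prednK // prednK //; exact: ltn_trans ij.
    exists (enum_rank_in tT [tuple Ordinal ai; Ordinal bj]) => //.
    apply: has_ratios_uniq ijp => //.
    have := fP (enum_rank_in tT [tuple Ordinal ai; Ordinal bj]).
    rewrite /fst_ /snd_ enum_rankK_in // !(tnth_nth (Ordinal ai)) /= !prednK //.
    exact: ltn_trans ij.
  have [u [v [rat pd]]] := fP k; split; first by apply/waring_rank2P; exists u, v.
  apply: (ratios_multiple l12 l13 l23 z_prim _ _ rat pd).
    by rewrite exprAC (prim_expr_order z_prim) expr1n.
  by rewrite exprAC (prim_expr_order z_prim) expr1n.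
rewrite -cardT; apply: card_eq_trans (inj_card_eq _) _; first by move=> k k' _ _; apply: f_inj.
by rewrite card_eq_sym card_II.
Qed.

End Counting.

(** The factors u - v, u - z v and u - z^2 v of u^d - v^d are pairwise independent and serve as the
    triple. *)
Lemma power_difference_multiple (R : realType) n (p : pform R n.+4) u v :
  is_power_difference u v p -> exists l1 l2 l3,
    [/\ br l1 l2 != 0, br l1 l3 != 0, br l2 l3 != 0 & multiple l1 l2 l3 p].
Proof.
move=> pd; have [uv _] := pd; have [c c0 E] := power_difference_rep pd.
have [z z_prim] := prim_root_exists R[i] (ltn0Sn n.+3).
pose i1 : 'I_n.+4 := Ordinal (isT : 1 < n.+4)%N.
pose i2 : 'I_n.+4 := Ordinal (isT : 2 < n.+4)%N.
pose l (i : 'I_n.+4) := u - scale (z ^+ i) v.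
have lE (i : 'I_n.+4) : br u (l i) = z ^+ i * br v (l i).
  by rewrite /l /br /=; ring.
have ll (i j : 'I_n.+4) : (i < j)%N -> br (l i) (l j) != 0.
  move=> ij; rewrite (_ : br _ _ = (z ^+ i - z ^+ j) * br u v).
    by rewrite mulf_neq0 // subr_eq0 (prim_expr_neq z_prim).
  by rewrite /l /br /=; ring.
exists (l ord0), (l i1), (l i2); split; rewrite ?ll //.
have [G GE] := three_roots_dvd z_prim uv (ll ord0 i1 isT) (ll ord0 i2 isT) (ll i1 i2 isT)
  (lE ord0) (lE i1) (lE i2).
by exists (c *: G); rewrite E -scalerAl -GE.
Qed.

Local Open Scope classical_set_scope.

Theorem theorem4p14 (R : realType) (d : nat) (d_ge4 : (4 <= d)%N) :
  (forall L : 3.-tuple (pform R 1), uniq L ->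
     ([set F : pform R d | pwaring_rank F 2 /\ triple_multiples L F]
        #= `I_'C(d - 1, 2))%card)
  /\
  \bigcup_(L in [set L : 3.-tuple (pform R 1) | uniq L])
     (triple_multiples L `&` zariski_closure (secant_union R d))
    = secant_union R d `\` rational_normal_curve R d
  /\
  secant_union R d `\` rational_normal_curve R d
    = [set F : pform R d | pwaring_rank F 2].
Proof.
case: d d_ge4 => [|[|[|[|n]]]] // _; split=> [L uL|].
  have [l1 [l2 [l3 [l12 l13 l23 LE]]]] := uniq_triple_lforms n uL.
  have [z z_prim] := prim_root_exists R[i] (ltn0Sn n.+3).
  rewrite subn1 /= (_ : mkset _ =
    [set p : pform R n.+4 | pwaring_rank p 2 /\ multiple l1 l2 l3 p]).
    exact: (card_multiples l12 l13 l23 z_prim).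
  by apply/seteqP; split=> p [? /LE].
split; apply/seteqP; split=> p.
- move=> [L /= uL].
  have [l1 [l2 [l3 [l12 l13 l23 LE]]]] := uniq_triple_lforms n uL.
  move=> [/LE mul /closure_catalecticant cat].
  by apply/secant_not_curveP; have := catalecticant_multiple l12 l13 l23 cat mul.
- move=> pS; have /secant_not_curveP[u [v pd]] := pS.
  have [l1 [l2 [l3 [l12 l13 l23 mul]]]] := power_difference_multiple pd.
  have [L uL LE] := lforms_triple n l12 l13 l23.
  exists L => //; split; first exact/LE.
  (* A point of the secant union lies in every closed set containing it, hence in the closure. *)
  by case: pS => pS _ A [_ SA]; apply: SA.
- by move=> /secant_not_curveP/waring_rank2P.
by move=> /waring_rank2P/secant_not_curveP.
Qed.
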